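(* Let $n\ge 2$ and $d$ be integers. Then $G(\alpha;n,d,n)$ is non-empty for some $\alpha\in\mathbb{R}$ if and only if $d>n$. Moreover, if $d>n$, there is no upper bound on $\alpha$, i.e. the set $\{\alpha\in\mathbb{R} : G(\alpha;n,d,n)\neq\emptyset\}$ is not bounded above.
   Context: Work on the projective line $\mathbb{P}^1$ over an algebraically closed field. A coherent system of type $(n,d,k)$ is a pair $(E,V)$ where $E$ is a vector bundle of rank $n$ and degree $d$ on $\mathbb{P}^1$ and $V\subset H^0(E)$ is a vector subspace of dimension $k$. For $\alpha\in\mathbb{R}$ its $\alpha$-slope is $\mu_\alpha(E,V)=\frac{d}{n}+\alpha\frac{k}{n}$. A coherent subsystem of $(E,V)$ is a coherent system $(E',V')$ with $E'$ a (nonzero) subbundle of $E$ and $V'\subset V\cap H^0(E')$; it is proper if $(E',V')\neq(E,V)$. $(E,V)$ is $\alpha$-stable if $\mu_\alpha(E',V')<\mu_\alpha(E,V)$ for every proper coherent subsystem $(E',V')$. $G(\alpha;n,d,k)$ denotes the moduli space of $\alpha$-stable coherent systems of type $(n,d,k)$ on $\mathbb{P}^1$. *)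

(* Defs.v *)
From mathcomp Require Import all_boot all_order all_algebra.
From mathcomp Require Import fraction.
From mathcomp Require Import boolp classical_sets reals.

Set Implicit Arguments.
Unset Strict Implicit.
Unset Printing Implicit Defensive.

Import Order.TTheory GRing.Theory Num.Theory.
Local Open Scope classical_set_scope.
Local Open Scope ring_scope.

(* P^1 is covered by two affine lines, with coordinate rings F[t] and F[1/t];
   both are modelled by {poly F} and compared inside the function field F(t).
   A vector bundle on an affine line is trivial (F[t] is a PID), so a vector
   bundle of rank n on P^1 is exactly a transition matrix in
   GL_n(F[t, 1/t]). *)

Section VectorBundles.
Variable F : closedFieldType.

Definition funfield : fieldType := {fraction {poly F}}.

Definition cst_fun (c : F) : funfield := tofrac c%:P.

Definition tvar : funfield := tofrac 'X.

Definition res0 (p : {poly F}) : funfield := tofrac p.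

Definition res1 (p : {poly F}) : funfield := (map_poly cst_fun p).[tvar^-1].

Definition laurent (f : funfield) : Prop :=
  exists (p : {poly F}) (N : nat), f = res0 p / tvar ^+ N.

Record bundle (n : nat) := Bundle {
  trans : 'M[funfield]_n ;
  trans_unit : trans \in unitmx ;
  trans_laurent : forall i j, laurent (trans i j) ;
  trans_inv_laurent : forall i j, laurent (invmx trans i j) }.

(* The determinant line bundle has transition function c t^d.  With the gluing
   convention s0 = trans * s1 below, t^d is the transition function of O(d). *)
Definition has_degree n (E : bundle n) (d : int) : Prop :=
  exists2 c : F, c != 0 & \det (trans E) = cst_fun c * tvar ^ d.

Definition local_sections (n : nat) : Type :=
  ('cV[{poly F}]_n * 'cV[{poly F}]_n)%type.

Definition H0 n (E : bundle n) : set (local_sections n) :=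
  [set s | map_mx res0 s.1 = trans E *m map_mx res1 s.2].

(* The F-linear combination of b_1, ..., b_k with coefficients c_1, ..., c_k;
   F acts through the constant polynomials. *)
Definition lincomb n k (b : 'I_k -> local_sections n) (c : 'I_k -> F) :
    local_sections n :=
  (\sum_(i < k) (c i)%:P *: (b i).1, \sum_(i < k) (c i)%:P *: (b i).2).

(* V is an F-linear subspace of dimension k: it has a basis of k elements. *)
Definition subspace_dim n (V : set (local_sections n)) (k : nat) : Prop :=
  exists b : 'I_k -> local_sections n,
    (forall c : 'I_k -> F, lincomb b c = 0 -> forall i, c i = 0) /\
    V = [set lincomb b c | c in [set: 'I_k -> F]].

Record bundle_hom m n (E' : bundle m) (E : bundle n) := BundleHom {
  hom0 : 'M[{poly F}]_(n, m) ;
  hom1 : 'M[{poly F}]_(n, m) ;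
  hom_glue : map_mx res0 hom0 *m trans E' = trans E *m map_mx res1 hom1 }.

Definition hom_sections m n (E' : bundle m) (E : bundle n)
    (f : bundle_hom E' E) (s : local_sections m) : local_sections n :=
  (hom0 f *m s.1, hom1 f *m s.2).

Definition bundle_iso m n (E' : bundle m) (E : bundle n)
    (f : bundle_hom E' E) : Prop :=
  exists g : bundle_hom E E',
    [/\ hom0 f *m hom0 g = 1%:M, hom0 g *m hom0 f = 1%:M,
        hom1 f *m hom1 g = 1%:M & hom1 g *m hom1 f = 1%:M].

(* f embeds E' as a subbundle (locally a direct summand) of E: it is injective
   on the fibre at every point of both charts. *)
Definition subbundle m n (E' : bundle m) (E : bundle n)
    (f : bundle_hom E' E) : Prop :=
  (forall x : F, \rank (map_mx (horner_eval x) (hom0 f)) = m) /\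
  (forall y : F, \rank (map_mx (horner_eval y) (hom1 f)) = m).

Record coherent_system (n : nat) (d : int) (k : nat) := CoherentSystem {
  cs_bundle :> bundle n ;
  cs_degree : has_degree cs_bundle d ;
  cs_space : set (local_sections n) ;
  cs_space_H0 : cs_space `<=` H0 cs_bundle ;
  cs_space_dim : subspace_dim cs_space k }.

Definition cs_iso n' d' k' n d k (S' : coherent_system n' d' k')
    (S : coherent_system n d k) (f : bundle_hom S' S) : Prop :=
  bundle_iso f /\ hom_sections f @` cs_space S' = cs_space S.

Definition coherent_subsystem n' d' k' n d k (S' : coherent_system n' d' k')
    (S : coherent_system n d k) (f : bundle_hom S' S) : Prop :=
  [/\ (0 < n')%N, subbundle f & hom_sections f @` cs_space S' `<=` cs_space S].

(* A subsystem is presented by an embedding f; it is the whole of S exactly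
   when f is an isomorphism of coherent systems. *)
Definition proper_subsystem n' d' k' n d k (S' : coherent_system n' d' k')
    (S : coherent_system n d k) (f : bundle_hom S' S) : Prop :=
  coherent_subsystem f /\ ~ cs_iso f.

Definition slope (R : realType) (alpha : R) (n : nat) (d : int) (k : nat) : R :=
  d%:~R / n%:R + alpha * (k%:R / n%:R).

Definition stable (R : realType) (alpha : R) n d k
    (S : coherent_system n d k) : Prop :=
  forall (n' : nat) (d' : int) (k' : nat) (S' : coherent_system n' d' k')
    (f : bundle_hom S' S),
  proper_subsystem f -> slope alpha n' d' k' < slope alpha n d k.

(* The set of points of G(alpha; n, d, k): the isomorphism classes of
   alpha-stable coherent systems of type (n, d, k). *)
Definition moduli (R : realType) (alpha : R) (n : nat) (d : int) (k : nat) :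
    set (set (coherent_system n d k)) :=
  [set C | exists2 S : coherent_system n d k, stable alpha S &
    C = [set S' : coherent_system n d k |
          exists f : bundle_hom S' S, cs_iso f]].

End VectorBundles.

Arguments moduli F {R} alpha n d k _.

(* Main.v *)
Require Import Defs.
From mathcomp Require Import all_boot all_order all_algebra.
From mathcomp Require Import boolp classical_sets reals.
From HB Require Import structures.
From mathcomp Require Import fraction zify ring lra.

Set Implicit Arguments.
Unset Strict Implicit.
Unset Printing Implicit Defensive.

Import Order.TTheory GRing.Theory Num.Theory.
Local Open Scope classical_set_scope.
Local Open Scope ring_scope.

(** Necessity of d > n.  Let (E, V) be alpha-stable of type (n, d, n).  A nonzero
    section s in V spans a line subbundle of some degree e >= 0, and the
    subsystem formed by this line and s has alpha-slope e + alpha, while (E, V)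
    has alpha-slope d / n + alpha; so stability says n e < d ([stable_section]).
    In particular d > 0.  The evaluation map from the trivial bundle with fibre V
    to E goes between bundles of rank n and its determinant is a section of a
    line bundle of degree d > 0, hence vanishes at some point; there some nonzero
    s in V vanishes, so e >= 1 and n < d ([stable_degree_gt]).

    Existence for d > n.  A single pair (E, V) is stable for every alpha > n d,
    which gives unboundedness at the same time.  Let E be the elementary
    modification of the trivial bundle of rank n at t = 0 obtained by adjoining
    t^-d (1, -t, ..., -t^(n-1)), and let V be the space of constant sections.
    The trivial bundle generated by V agrees with E away from t = 0, and E has
    degree d.  Consider a subsystem of type (n', d', k').  Since constant vectors
    independent over the constants stay independent at every point, k' <= n'.
    Degrees of subbundles are bounded ([subbundle_degree_le]), so for k' < n' the
    term alpha k' / n' makes the slope smaller once alpha is large.  For k' = n'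
    the alpha-terms cancel and d' / n' < d / n has to be shown.  Here the
    subbundle is the saturation of the constant bundle of an n'-dimensional
    subspace of V, and d' is the order of contact at t = 0 of this subspace with
    the curve (1, -t, ..., -t^(n-1)), at most d.  This is a rational normal curve,
    so the order of contact is at most n'; in terms of matrices, after a constant
    change of rows some maximal minor has order at most n' at t = 0
    ([low_order_minor]).  Thus d' <= n' ([generated_degree_le]), and
    d' / n' <= 1 < d / n. *)

(** * Gluing functions of t and of 1/t *)

HB.instance Definition _ (F : closedFieldType) :=
  GRing.RMorphism.copy (@cst_fun F) (@tofrac {poly F} \o polyC).
HB.instance Definition _ (F : closedFieldType) :=
  GRing.RMorphism.copy (@res0 F) (@tofrac {poly F}).
HB.instance Definition _ (F : closedFieldType) :=
  GRing.RMorphism.copy (@res1 F)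
    (horner_eval (tvar F)^-1 \o map_poly (@cst_fun F)).

Section FunctionField.
Variable F : closedFieldType.
Implicit Types (p q : {poly F}) (c : F) (N : nat) (f g : funfield F).
Local Notation t := (tvar F).

Lemma res0_inj : injective (@res0 F).
Proof. by move=> p q /eqP; rewrite tofrac_eq => /eqP. Qed.

Lemma res0_eq0 p : (res0 p == 0) = (p == 0).
Proof. exact: tofrac_eq0. Qed.

Lemma tvar_neq0 : t != 0.
Proof. by rewrite /tvar tofrac_eq0 polyX_eq0. Qed.

Lemma res0X N : res0 ('X^N : {poly F}) = t ^+ N.
Proof. by rewrite rmorphXn. Qed.

Lemma res0C c : res0 c%:P = cst_fun c.
Proof. by []. Qed.

Lemma res1C c : res1 c%:P = cst_fun c.
Proof. by rewrite /res1 map_polyC hornerC. Qed.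

Lemma res1X N : res1 ('X^N : {poly F}) = t ^- N.
Proof. by rewrite rmorphXn /= /res1 map_polyX hornerX exprVn. Qed.

Lemma res1_reverse N q : (size q <= N.+1)%N ->
  t ^+ N * res1 q = res0 (\poly_(i < N.+1) q`_(N - i)).
Proof.
move=> szq; rewrite /res1 (@horner_coef_wide _ N.+1) ?size_map_poly //.
rewrite poly_def raddf_sum mulr_sumr (reindex_inj rev_ord_inj) /=.
apply: eq_bigr => i _; rewrite coef_map /= subSS.
rewrite -mul_polyC rmorphM /= res0X mulrCA; congr (_ * _).
have iN : (i <= N)%N by rewrite -ltnS.
rewrite -{1}(subnKC iN) exprD exprVn mulfK //.
by rewrite expf_neq0 // tvar_neq0.
Qed.

(** Comparing coefficients of the two Laurent expansions: the exponents on the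
    left are at least k, those on the right at most 0, so the coefficients of p
    and of q can only live in degrees up to -k. *)
Lemma coef_glue p q (k : int) : res0 p * t ^ k = res1 q ->
  (forall j : nat, 0 < j%:Z + k -> q`_j = 0 /\ p`_j = 0).
Proof.
move=> E j jk.
(* N is large enough to clear the denominators on both sides. *)
pose N := (size q + `|k|)%N.
have [M Mk] : exists M : nat, N%:Z + k = M%:Z.
  by exists (absz (N%:Z + k)); rewrite /N; lia.
have : p * 'X^M = \poly_(i < N.+1) q`_(N - i).
  apply: res0_inj; rewrite -res1_reverse; last by rewrite /N; lia.
  rewrite rmorphM /= res0X -E mulrCA; congr (_ * _).
  by rewrite [t ^+ M]exprnP [t ^+ N]exprnP -Mk expfzDr ?tvar_neq0.
move/polyP => pq; split; last first.
  by move: (pq (j + M)%N); rewrite coefMXn coef_poly ltnNge leq_addl /= addnK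
   => ->; case: ifP => // h; lia.
have [jN|Nj] := leqP j N; last first.
  by apply: nth_default; apply: leq_trans (leq_addr _ _) (ltnW Nj).
move: (pq (N - j)%N); rewrite coefMXn coef_poly.
have -> : (N - j < M)%N by lia.
by rewrite ltnS leq_subr subKn.
Qed.

(** For d = 0: the degree e of a line bundle bounds the degrees of both local
    expressions p and q of a section.  A second exponent makes the statement
    apply to determinants of morphisms between bundles. *)
Lemma size_glue p q (d e : int) : res0 p * t ^ d = t ^ e * res1 q ->
  p != 0 -> q != 0 -> (size p).-1%:Z + d <= e /\ (size q).-1%:Z + d <= e.
Proof.
move=> pq p0 q0; have /coef_glue E : res0 p * t ^ (d - e) = res1 q.
  rewrite expfzDr ?tvar_neq0 // mulrA pq mulrAC -expfzDr ?tvar_neq0 //.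
  by rewrite subrr expr0z mul1r.
split; rewrite -subr_le0 -addrA leNgt; apply/negP => /E[].
- by move=> _ /eqP; rewrite -lead_coefE lead_coef_eq0 (negPf p0).
- by move=> /eqP; rewrite -lead_coefE lead_coef_eq0 (negPf q0).
Qed.

Lemma res1_eq0 q : (res1 q == 0) = (q == 0).
Proof.
apply/eqP/eqP => [q0|->]; last by rewrite rmorph0.
have E : res0 (0 : {poly F}) * t ^ (1:int) = res1 q.
  by rewrite q0 rmorph0 mul0r.
apply/polyP => j; rewrite coef0.
by have [|-> _ //] := coef_glue E (j := j); lia.
Qed.

Lemma laurent_res0 p : laurent (res0 p).
Proof. by exists p, 0; rewrite expr0 divr1. Qed.

Lemma laurent_tvarX N : laurent (t ^- N).
Proof. by exists 1, N; rewrite rmorph1 div1r. Qed.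

Lemma laurentM f g : laurent f -> laurent g -> laurent (f * g).
Proof.
move=> [p [N ->]] [q [M ->]]; exists (p * q), (N + M)%N.
by rewrite rmorphM /= exprD invfM mulrACA.
Qed.

Lemma laurentD f g : laurent f -> laurent g -> laurent (f + g).
Proof.
move=> [p [N ->]] [q [M ->]]; exists (p * 'X^M + q * 'X^N), (N + M)%N.
rewrite rmorphD !rmorphM /= !res0X exprD.
by rewrite addf_div // expf_neq0 // tvar_neq0.
Qed.

Lemma laurent_res1 q : laurent (res1 q).
Proof.
have E := @res1_reverse (size q) q (leqnSn _).
exists (\poly_(i < (size q).+1) q`_((size q) - i)), (size q).
by rewrite -E mulrAC divff ?mul1r // expf_neq0 // tvar_neq0.
Qed.

Lemma laurent_mulmx m n k (A : 'M[funfield F]_(m, n))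
    (B : 'M[funfield F]_(n, k)) :
    (forall i j, laurent (A i j)) -> (forall i j, laurent (B i j)) ->
  forall i j, laurent ((A *m B) i j).
Proof.
move=> lA lB i j; rewrite mxE.
elim/big_ind: _ => [|f g|l _]; [|exact: laurentD|exact: laurentM].
by have := laurent_res0 0; rewrite rmorph0.
Qed.

(** The numerator of a unit divides a power of t, and t is prime. *)
Lemma laurent_unit f g : laurent f -> laurent g -> f * g = 1 ->
  exists2 c, c != 0 & exists e : int, f = cst_fun c * t ^ e.
Proof.
move=> [p [N ->]] [q [M ->]] E.
have tN K : t ^+ K != 0 by rewrite expf_neq0 // tvar_neq0.
have pq : p * q = 'X^(N + M).
  apply: res0_inj; rewrite rmorphM /= res0X exprD -[RHS]mulr1 -E mulf_div.
  by rewrite mulrCA divff ?mulr1 // mulf_neq0.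
have : p %| ('X - 0%:P) ^+ (N + M) by rewrite subr0 -pq dvdp_mulr.
case/dvdp_exp_XsubCP => k _; rewrite subr0 => /eqpP[[a b] /= /andP[a0 b0]].
move=> /(congr1 (fun x => a^-1 *: x)); rewrite !scalerA mulVf // scale1r => ->.
exists (a^-1 * b); first by rewrite mulf_neq0 // invr_eq0.
exists (k%:Z - N%:Z); rewrite -mul_polyC rmorphM /= res0X res0C -mulrA.
by rewrite expfzDr ?tvar_neq0 // -exprnN.
Qed.

End FunctionField.

(** * Polynomial matrices and the line through a section *)

Lemma scalemx_inj (D : idomainType) m n (a : D) : a != 0 ->
  injective (fun A : 'M[D]_(m, n) => a *: A).
Proof.
move=> a0 A B /matrixP AB; apply/matrixP => i j.
by have := AB i j; rewrite !mxE => /(mulfI a0).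
Qed.

(** Bezout in the principal ideal domain K[t]: the gcd g of the entries is found
    as a combination w *m u of least size, which divides every entry. *)
Lemma primitive_part_cV (K : fieldType) n (u : 'cV[{poly K}]_n) : u != 0 ->
  exists g u', [/\ g != 0, u = g *: u' & exists w : 'rV_n, w *m u' = 1%:M].
Proof.
move=> u0.
pose P (m : nat) := `[< exists w : 'rV[{poly K}]_n,
   (w *m u) 0 0 != 0 /\ size ((w *m u) 0 0) = m >].
have exP : exists m, P m.
  have /cV0Pn[i ui] := u0.
  exists (size (u i 0)); apply/asboolP; exists (delta_mx 0 i).
  by rewrite -rowE mxE.
case: (ex_minnP exP) => m /asboolP[w [g0 szg] min_m].
set g := (w *m u) 0 0 in g0 szg.
have dvd_g i : g %| u i 0.
  apply/modp_eq0P; apply/eqP/negPn/negP => r0.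
  have : P (size (u i 0 %% g)).
    apply/asboolP; exists (delta_mx 0 i - (u i 0 %/ g) *: w).
    rewrite mulmxBl -rowE -scalemxAl !mxE.
    have -> : u i 0 - u i 0 %/ g * (\sum_j w 0 j * u j 0) = u i 0 %% g.
      rewrite {1}(divp_eq (u i 0) g) -[X in _ - _ * X]/(_) /g mxE.
      by rewrite addrC addKr.
    by [].
  by move/min_m; rewrite leqNgt -szg ltn_modp g0.
pose u' := \col_i (u i 0 %/ g).
have uE : u = g *: u'.
  by apply/colP => i; rewrite !mxE mulrC divpK.
exists g, u'; split => //; exists w; apply: (scalemx_inj g0).
rewrite /= scalemxAr -uE; apply/rowP => i.
by rewrite !ord1 !mxE mulr1 /g mxE.
Qed.

Section PolyMatrices.
Variable K : fieldType.

Lemma rank_left_inverse m n (A : 'M[{poly K}]_(n, m)) (B : 'M_(m, n)) x :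
  B *m A = 1%:M -> \rank (map_mx (horner_eval x) A) = m.
Proof.
move=> /(congr1 (map_mx (horner_eval x))); rewrite map_mxM map_mx1 => BA.
by apply/eqP; apply/row_fullP; exists (map_mx (horner_eval x) B).
Qed.

Lemma det_root_kernel n (A : 'M[{poly K}]_n) x : root (\det A) x ->
  exists2 c : 'cV[K]_n, c != 0 & map_mx (horner_eval x) A *m c = 0.
Proof.
move=> /eqP detA0.
have : \det (map_mx (horner_eval x) A)^T == 0.
  by rewrite det_tr det_map_mx /= /horner_eval detA0.
case/det0P => v v0 Av; exists v^T; first by rewrite trmx_eq0.
by apply: trmx_inj; rewrite trmx_mul trmxK Av trmx0.
Qed.

Lemma eval_const_mx m n (A : 'M[K]_(m, n)) x :
  map_mx (horner_eval x) (map_mx polyC A) = A.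
Proof. by apply/matrixP => i j; rewrite !mxE /horner_eval hornerC. Qed.

(** Injectivity on one fibre forces injectivity at the generic point; the
    constant matrix P selects the fibre coordinates that witness it. *)
Lemma left_inverse_at m n (A : 'M[{poly K}]_(n, m)) x :
  \rank (map_mx (horner_eval x) A) = m ->
  exists P : 'M[K]_(m, n), \det (map_mx polyC P *m A) != 0.
Proof.
move=> rA; have /row_fullP[P PA] : row_full (map_mx (horner_eval x) A).
  by rewrite /row_full rA.
exists P; apply: contra_eq_neq PA => dPA.
have : \det (map_mx (horner_eval x) (map_mx polyC P *m A)) = 0.
  by rewrite det_map_mx dPA; apply: rmorph0.
rewrite map_mxM eval_const_mx; apply: contra_eq_neq => ->.
by rewrite det1 oner_eq0.
Qed.

Lemma det_neq0_inj n p (A : 'M[{poly K}]_n) (B : 'M_(n, p)) :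
  \det A != 0 -> A *m B = 0 -> B = 0.
Proof.
move=> dA AB; apply: (scalemx_inj dA); rewrite scaler0 -mul_scalar_mx.
rewrite -mul_adj_mx.
by rewrite -mulmxA AB mulmx0.
Qed.

(** A primitive vector vanishes nowhere, so zeros of g *: u are zeros of g. *)
Lemma primitive_vanish n (g : {poly K}) (u : 'cV_n) (w : 'rV_n) x :
    w *m u = 1%:M -> map_mx (horner_eval x) (g *: u) = 0 -> g != 0 ->
  (0 < (size g).-1)%N.
Proof.
move=> wu gu0; apply: contra_neqT; rewrite -eqn0Ngt => /eqP szg.
have /size1_polyC gE : (size g <= 1)%N by case: (size g) szg => // -[].
have ga : horner_eval x g = g`_0 by rewrite {1}gE /horner_eval hornerC.
have := congr1 (mulmx (map_mx (horner_eval x) w)) gu0.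
rewrite map_mxZ /= ga -scalemxAr mulmx0 -map_mxM wu map_mx1.
by move=> /matrixP/(_ 0 0); rewrite !mxE mulr1 => g00; rewrite gE g00.
Qed.

End PolyMatrices.

Section Ratio.
Variable K : fieldType.

Lemma mulr1_invr (r r' : K) : r * r' = 1 -> r != 0 /\ r^-1 = r'.
Proof.
move=> rr'; have r0 : r != 0.
  by apply: contra_eq_neq rr' => ->; rewrite mul0r eq_sym oner_eq0.
by split=> //; apply: (mulfI r0); rewrite rr' divff.
Qed.

(** The saturation of the line spanned by one section, over an abstract field.
    The Bezout rows turn the ratio a / b of the two gcds, and its inverse, into
    matrix products, so both are Laurent as soon as T and its inverse are. *)
Lemma primitive_ratio n (T : 'M[K]_n) (u0 u1 : 'cV_n) (w0 w1 : 'rV_n)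
    (a b : K) :
    T \in unitmx -> a != 0 -> b != 0 -> w0 *m u0 = 1%:M -> w1 *m u1 = 1%:M ->
    a *: u0 = T *m (b *: u1) ->
  forall r r' : K, r = (w0 *m (T *m u1)) 0 0 ->
  r' = (w1 *m (invmx T *m u0)) 0 0 ->
  [/\ a = r * b, r * r' = 1 & u0 *m r%:M = T *m u1].
Proof.
move=> Tu a0 b0 wu0 wu1 glue r r' rdef r'def.
have entry (x : K) : (x%:M : 'M_1) 0 0 = x by rewrite mxE mulr1n.
have aE : a = r * b.
  rewrite -[LHS]entry -[a%:M]scalemx1 -wu0 scalemxAr glue -!scalemxAr.
  by rewrite [LHS]mxE mulrC rdef.
have bE : b = r' * a.
  rewrite -[LHS]entry -[b%:M]scalemx1 -wu1 scalemxAr.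
  rewrite -[b *: u1](mulKmx Tu) -glue -!scalemxAr.
  by rewrite [LHS]mxE mulrC r'def.
split=> //.
  by apply: (mulIf a0); rewrite mul1r -mulrA -bE -aE.
rewrite mul_mx_scalar; apply: (scalerI b0).
by rewrite scalerA mulrC -aE glue -scalemxAr.
Qed.

End Ratio.

Section Lines.
Variable F : closedFieldType.
Local Notation t := (tvar F).

(** A nonzero section factors through a line subbundle: dividing out the gcd of
    its coordinates in each chart leaves a nowhere vanishing section twisted by
    the divisor of zeros, whose degree is e.  Hence e >= 0, with e >= 1 once the
    section vanishes at a point of either chart. *)
Lemma line_of_section n (E : bundle F n) (s : local_sections F n) :
    H0 E s -> s != 0 ->
  exists (L : bundle F 1) (f : bundle_hom L E) (g : local_sections F 1)
      (e : int),
    [/\ has_degree L e, subbundle f, H0 L g /\ hom_sections f g = s, 0 <= e &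
      ((exists x, map_mx (horner_eval x) s.1 = 0) \/
       (exists y, map_mx (horner_eval y) s.2 = 0)) -> 1 <= e].
Proof.
case: s => s0 s1 /= Es s_neq0; rewrite /H0 /= in Es.
have Tu := trans_unit E.
have s0_neq0 : s0 != 0.
  apply: contra_neq s_neq0 => s00; rewrite s00; congr (_, _).
  have {Es}: trans E *m map_mx (@res1 F) s1 = 0 by rewrite -Es s00 map_mx0.
  move/(congr1 (mulmx (invmx (trans E)))); rewrite mulKmx // mulmx0.
  move=> /matrixP s10; apply/matrixP => i j; have /eqP := s10 i j.
  by rewrite !mxE res1_eq0 => /eqP.
have s1_neq0 : s1 != 0.
  apply: contra_neq s0_neq0 => s10; move: Es; rewrite s10 map_mx0 mulmx0.
  move=> /matrixP s00; apply/matrixP => i j; have /eqP := s00 i j.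
  by rewrite !mxE res0_eq0 => /eqP.
have [g0 [u0 [g0_neq0 Eu0 [w0 wu0]]]] := primitive_part_cV s0_neq0.
have [g1 [u1 [g1_neq0 Eu1 [w1 wu1]]]] := primitive_part_cV s1_neq0.
have glue : res0 g0 *: map_mx (@res0 F) u0 =
            trans E *m (res1 g1 *: map_mx (@res1 F) u1).
  by rewrite -!map_mxZ -Eu0 -Eu1.
have wu0' : map_mx (@res0 F) w0 *m map_mx (@res0 F) u0 = 1%:M.
  by rewrite -map_mxM wu0 map_mx1.
have wu1' : map_mx (@res1 F) w1 *m map_mx (@res1 F) u1 = 1%:M.
  by rewrite -map_mxM wu1 map_mx1.
have G0 : res0 g0 != 0 by rewrite res0_eq0.
have G1 : res1 g1 != 0 by rewrite res1_eq0.
pose r := (map_mx (@res0 F) w0 *m (trans E *m map_mx (@res1 F) u1)) 0 0.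
pose r' :=
  (map_mx (@res1 F) w1 *m (invmx (trans E) *m map_mx (@res0 F) u0)) 0 0.
have [rE rr' hom] :=
  primitive_ratio Tu G0 G1 wu0' wu1' glue (erefl r) (erefl r').
have [r0 rV] := mulr1_invr rr'.
have lr : laurent r.
  apply: laurent_mulmx => [i j|]; first by rewrite mxE; exact: laurent_res0.
  apply: laurent_mulmx; first exact: trans_laurent.
  by move=> i j; rewrite mxE; exact: laurent_res1.
have lr' : laurent r'.
  apply: laurent_mulmx => [i j|]; first by rewrite mxE; exact: laurent_res1.
  apply: laurent_mulmx; first exact: trans_inv_laurent.
  by move=> i j; rewrite mxE; exact: laurent_res0.
have [c c_neq0 [e re]] := laurent_unit lr lr' rr'.
have r_unit : (r%:M : 'M_1) \in unitmx by rewrite unitmxE det_scalar1 unitfE.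
have rl i j : laurent ((r%:M : 'M_1) i j) by rewrite !ord1 !mxE mulr1n.
have r'l i j : laurent (invmx (r%:M : 'M_1) i j).
  by rewrite invmx_scalar rV !ord1 !mxE mulr1n.
pose L := Bundle r_unit rl r'l.
exists L, (@BundleHom _ _ _ L E u0 u1 hom), (g0%:M, g1%:M), e.
have deg_glue : res0 g0 * t ^ 0 = t ^ e * res1 (c%:P * g1).
  by rewrite expr0z mulr1 rE {1}re rmorphM /= res1C mulrCA mulrA.
have cg1 : c%:P * g1 != 0 by rewrite mulf_neq0 // polyC_eq0.
have [] := size_glue deg_glue g0_neq0 cg1; rewrite !addr0 => szg0 szg1.
have e_ge0 : 0 <= e by apply: le_trans szg0.
split => //.
- by exists c => //; rewrite det_scalar1.
- by split => x; apply: rank_left_inverse; [exact: wu0 | exact: wu1].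
- split; first by rewrite /H0 /= !map_scalar_mx /= -scalar_mxM rE.
  by rewrite /hom_sections /= !mul_mx_scalar -Eu0 -Eu1.
- case=> -[x]; rewrite ?Eu0 ?Eu1 => vx.
  + by apply: le_trans szg0; apply: primitive_vanish wu0 vx g0_neq0.
  + apply: le_trans szg1; rewrite mul_polyC size_scale //.
    exact: primitive_vanish wu1 vx g1_neq0.
Qed.

End Lines.

(** * Stable systems have degree greater than the rank *)

Section Sections.
Variable F : closedFieldType.
Local Notation t := (tvar F).

(** The evaluation map F^k -> E of a family of k sections, in each chart. *)
Definition frame0 n k (b : 'I_k -> local_sections F n) : 'M[{poly F}]_(n, k) :=
  \matrix_(i, j) (b j).1 i 0.

Definition frame1 n k (b : 'I_k -> local_sections F n) : 'M[{poly F}]_(n, k) :=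
  \matrix_(i, j) (b j).2 i 0.

Lemma lincomb_frame n k (b : 'I_k -> local_sections F n) (c : 'cV_k) :
  lincomb b (fun i => c i 0) =
  (frame0 b *m map_mx polyC c, frame1 b *m map_mx polyC c).
Proof.
congr (_, _); apply/colP => i; rewrite summxE mxE; apply: eq_bigr => j _;
  by rewrite !mxE mulrC.
Qed.

Lemma frame_glue n k (E : bundle F n) (b : 'I_k -> local_sections F n) :
  (forall i, H0 E (b i)) ->
  map_mx (@res0 F) (frame0 b) = trans E *m map_mx (@res1 F) (frame1 b).
Proof.
move=> Eb; apply/matrixP => i j; have /matrixP/(_ i 0) := Eb j.
rewrite [LHS]mxE [RHS]mxE => E0; rewrite [LHS]mxE [RHS]mxE [frame0 b i j]mxE E0.
by apply: eq_bigr => l _; rewrite !mxE.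
Qed.

Lemma lincomb_delta n k (b : 'I_k -> local_sections F n) i :
  lincomb b (fun j => (j == i)%:R) = b i.
Proof.
rewrite /lincomb [RHS]surjective_pairing; congr (_, _);
  rewrite (bigD1 i) //= eqxx scale1r big1 ?addr0 // => j /negPf ->;
  by rewrite scale0r.
Qed.

Lemma lincomb_scale n k (b : 'I_k -> local_sections F n) a c :
  lincomb b (fun i => a * c i) =
  (a%:P *: (lincomb b c).1, a%:P *: (lincomb b c).2).
Proof.
by congr (_, _); rewrite /= scaler_sumr; apply: eq_bigr => i _;
  rewrite scalerA polyCM.
Qed.

Lemma bundle_iso_rank_ge m n (E' : bundle F m) (E : bundle F n)
    (f : bundle_hom E' E) : bundle_iso f -> (n <= m)%N.
Proof.
case=> g [fg _ _ _]; have /(_ 0) <- := rank_left_inverse _ fg.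
exact: rank_leq_row.
Qed.

End Sections.

Section Necessity.
Variables (F : closedFieldType) (R : realType).
Local Notation t := (tvar F).

Lemma slope_line (alpha : R) (n : nat) (e d : int) : (0 < n)%N ->
  slope alpha 1 e 1 < slope alpha n d n -> n%:Z * e < d.
Proof.
move=> n0; rewrite /slope !divr1 divff ?pnatr_eq0 -?lt0n // mulr1.
rewrite ltrD2r ltr_pdivlMr ?ltr0n //.
by rewrite -[n%:R]/(n%:Z%:~R) -intrM ltr_int mulrC.
Qed.

(** The line through a section s, with the span of s as its space of sections,
    is a proper subsystem of type (1, e, 1); its alpha-slope is e + alpha, so
    stability compares e with d / n whatever alpha is. *)
Lemma stable_section (alpha : R) n d (S : coherent_system F n d n)
    (s : local_sections F n) :
    (2 <= n)%N -> stable alpha S -> cs_space S s -> s != 0 ->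
  exists e : int, [/\ n%:Z * e < d, 0 <= e &
    ((exists x, map_mx (horner_eval x) s.1 = 0) \/
     (exists y, map_mx (horner_eval y) s.2 = 0)) -> 1 <= e].
Proof.
move=> n2 stS Vs s0.
have Es : H0 S s by exact: cs_space_H0.
have [L [f [g [e [degL subf [Lg fg] e_ge0 van]]]]] := line_of_section Es s0.
exists e; split => //.
pose b (_ : 'I_1) := g.
have lb c : lincomb b c = ((c 0)%:P *: g.1, (c 0)%:P *: g.2).
  by rewrite /lincomb !big_ord1.
pose V := [set lincomb b c | c in [set: 'I_1 -> F]].
have VH0 : V `<=` H0 L.
  move=> _ [c _ <-]; rewrite lb /H0 /= !map_mxZ /= -scalemxAr Lg.
  by rewrite /= res1C.
have Vdim : subspace_dim V 1.
  exists b; split => // c; rewrite lb => -[g10 g20] i; rewrite ord1.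
  apply/eqP; apply: contra_neqT s0 => c0.
  have cP0 : (c 0)%:P != 0 by rewrite polyC_eq0.
  have g1 : g.1 = 0 by apply: (scalemx_inj cP0); rewrite /= scaler0.
  have g2 : g.2 = 0 by apply: (scalemx_inj cP0); rewrite /= scaler0.
  by rewrite -fg /hom_sections g1 g2 !mulmx0.
pose SL := CoherentSystem degL VH0 Vdim.
have prop : proper_subsystem (S' := SL) (S := S) f.
  split; last by move=> [/bundle_iso_rank_ge]; rewrite leqNgt n2.
  split=> // _ [_ [c _ <-] <-]; rewrite lb.
  have [bS [_ VE]] := cs_space_dim S; rewrite VE in Vs *.
  case: Vs => a _ as_; exists (fun i => c 0 * a i) => //.
  by rewrite lincomb_scale as_ -fg /hom_sections /= !scalemxAr.
by apply: slope_line (ltnW n2) (stS _ _ _ SL f prop).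
Qed.

(** Any section gives n * 0 < d.  A section with a zero then gives n * 1 < d; it
    exists because the evaluation map V -> E between spaces of equal rank n has
    a determinant of positive degree d, which must vanish somewhere. *)
Lemma stable_degree_gt (alpha : R) n d (S : coherent_system F n d n) :
  (2 <= n)%N -> stable alpha S -> n%:Z < d.
Proof.
move=> n2 stS.
have [b [b_free VE]] := cs_space_dim S.
pose s (c : 'cV[F]_n) := lincomb b (fun i => c i 0).
have sV c : cs_space S (s c) by rewrite VE; exists (fun i => c i 0).
have s_neq0 c : c != 0 -> s c != 0.
  by apply: contra_neq => /b_free c0; apply/colP => i; rewrite c0 mxE.
have d_gt0 : 0 < d.
  have d0 : const_mx 1 != 0 :> 'cV[F]_n.
    by apply/cV0Pn; exists (Ordinal (ltnW n2)); rewrite mxE oner_eq0.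
  have [e [ne e0 _]] := stable_section n2 stS (sV _) (s_neq0 _ d0).
  by apply: le_lt_trans ne; apply: mulr_ge0.
pose vanishing c := (exists x, map_mx (horner_eval x) (s c).1 = 0) \/
                    (exists y, map_mx (horner_eval y) (s c).2 = 0).
suff [c c0 van] : exists2 c : 'cV[F]_n, c != 0 & vanishing c.
  have [e [ne _ /(_ van) e1]] := stable_section n2 stS (sV _) (s_neq0 _ c0).
  by apply: le_lt_trans ne; rewrite ler_peMr.
have root_van (x : F) : root (\det (frame0 b)) x \/ root (\det (frame1 b)) x ->
    exists2 c : 'cV[F]_n, c != 0 & vanishing c.
  case=> /det_root_kernel[c c0 Ac]; exists c => //; [left|right]; exists x;
    by rewrite /s lincomb_frame /= map_mxM eval_const_mx.
have [s0|] := eqVneq (size (\det (frame0 b))) 1%N; last first.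
  by move/closed_rootP => [x rx]; apply: (root_van x); left.
have [s1|] := eqVneq (size (\det (frame1 b))) 1%N; last first.
  by move/closed_rootP => [x rx]; apply: (root_van x); right.
have [a0 a0n E0] : exists2 a, a != 0 & \det (frame0 b) = a%:P.
  exact/size_poly1P/eqP.
have [a1 a1n E1] : exists2 a, a != 0 & \det (frame1 b) = a%:P.
  exact/size_poly1P/eqP.
have bH i : H0 S (b i).
  by apply: cs_space_H0; rewrite -(lincomb_delta b i) VE; eexists.
have [c c0 dE] := cs_degree S.
have := congr1 (fun A => \det A) (frame_glue bH).
rewrite /= det_mulmx !det_map_mx dE E0 E1 /= res1C => D.
(* Constants belong to both charts; exchanging these two bounds d from above. *)
have D' : res0 (c * a1)%:P * t ^ d = t ^ 0 * res1 a0%:P.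
  by rewrite expr0z mul1r res0C res1C -[RHS]res0C D rmorphM /= mulrAC.
have [] := size_glue D'; rewrite ?polyC_eq0 ?mulf_neq0 //.
by rewrite size_polyC mulf_neq0 // add0r leNgt d_gt0.
Qed.

End Necessity.

(** * Minors of the modification matrix *)

(** Sylvester's identity for a rank one perturbation: both sides are the
    determinant of block_mx 1 u z 1, eliminated in two orders. *)
Lemma det_1Bmul (D : comNzRingType) r (z : 'cV[D]_r) (u : 'rV[D]_r) :
  \det (1%:M - z *m u) = (1%:M - u *m z) 0 0.
Proof.
have : block_mx 1%:M 0 z 1%:M *m block_mx 1%:M u 0 (1%:M - z *m u) =
       block_mx (1%:M - u *m z) u 0 1%:M *m block_mx 1%:M 0 z 1%:M
       :> 'M[D]_(1 + r).
  rewrite !mulmx_block !mul1mx !mulmx1 !mul0mx !mulmx0 !addr0 !add0r.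
  by rewrite !subrK addrC subrK.
move/(congr1 (fun A => \det A)); rewrite !det_mulmx !det_lblock !det_ublock.
by rewrite !det1 !mul1r !mulr1 det_mx11.
Qed.

Section ModificationMatrix.
Variable K : fieldType.

Definition curve_col p : 'cV[{poly K}]_p := \col_(i < p) 'X^(i.+1).

(** The elementary modification of the trivial bundle at t = 0 along the jet of
    the rational normal curve: F[t]^(1 + p) is enlarged by the single vector
    t^-m (1, -t, ..., -t^p), and this matrix expresses the old basis in the
    basis made of that vector and of the last p old ones. *)
Definition modif_mx p m : 'M[{poly K}]_(1 + p) :=
  block_mx ('X^m)%:M 0 (curve_col p) 1%:M.

(** The matrix t^-m * modif_mx p m, written in the coordinate 1/t. *)
Definition modif_mx_at_infty p m : 'M[{poly K}]_(1 + p) :=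
  block_mx 1%:M 0 (\col_(i < p) 'X^(m - i.+1)) ('X^m)%:M.

Lemma full_rank_cV n r (C : 'M[K]_(n, r)) :
  (forall a : 'cV_r, C *m a = 0 -> a = 0) -> \rank C = r.
Proof.
move=> C_inj; rewrite -mxrank_tr; apply/eqP.
rewrite -[_ == _]/(row_free C^T) -kermx_eq0; apply/eqP/row_matrixP => i.
rewrite row0; apply: trmx_inj; rewrite trmx0; apply: C_inj.
by rewrite -[X in X *m _]trmxK -trmx_mul -row_mul mulmx_ker row0 trmx0.
Qed.

(** The left kernel of C has dimension greater than p - r, hence cannot be
    contained in the space of rows whose first r coordinates are zero. *)
Lemma kernel_first_coords p r (C : 'M[K]_(p, r)) : (r <= p)%N ->
  (\rank C < r)%N ->
  exists (q : 'rV_p) (j : 'I_p), [/\ q *m C = 0, (j < r)%N & q 0 j != 0].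
Proof.
move=> rp rC; pose A := kermx C *m (pid_mx r : 'M_(p, r)).
have : A != 0.
  apply/eqP => /mulmx0_rank_max.
  by rewrite mxrank_ker rank_pid_mx // leqNgt; apply/negP/negPn; lia.
case/matrix0Pn => i [j Aij]; pose j' := widen_ord rp j.
exists (row i (kermx C)), j'; split.
- by rewrite -row_mul mulmx_ker row0.
- exact: ltn_ord j.
apply/eqP => Kij; case/eqP: Aij; rewrite mxE (bigD1 j') //= big1 => [|l lj].
  by move: Kij; rewrite !mxE => ->; rewrite mul0r addr0.
rewrite !mxE; case: eqP => [lj'|]; last by rewrite mulr0.
by case/eqP: lj; apply: val_inj.
Qed.

Lemma coef_row_curve_col p (q : 'rV[K]_p) (j : 'I_p) :
  ((map_mx polyC q *m curve_col p) 0 0)`_j.+1 = q 0 j.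
Proof.
rewrite mxE coef_sum (bigD1 j) //= big1 ?addr0 => [|i ij].
  by rewrite !mxE coefCM coefXn eqxx mulr1.
rewrite !mxE coefCM coefXn eqSS eq_sym.
by rewrite (inj_eq val_inj) (negPf ij) mulr0.
Qed.

(** The general position property of the rational normal curve, as a bound on
    the order at t = 0 of maximal minors.  Write u for the first row of C and C'
    for the others, v for the column (t, ..., t^p), and restrict to P = (0 | Q):
    the minor is det (Q C' + (Q v) u).  If C' has a left inverse Q, this is 1
    modulo t.  Otherwise C' kills a vector a with u a = 1, and a left inverse of
    C yields a Q with Q C' = 1 - a u and with u Q = q a prescribed row of the
    left kernel of C'; the minor is then q v = q_1 t + ... + q_p t^p, and q can
    be chosen nonzero among its first r coordinates. *)
Lemma low_order_minor p m r (C : 'M[K]_(1 + p, r)) : (r <= p)%N ->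
  \rank C = r ->
  exists (P : 'M[K]_(r, 1 + p)) (j : nat), (j <= r)%N /\
    (\det (map_mx polyC P *m (modif_mx p m *m map_mx polyC C)))`_j != 0.
Proof.
move=> rp rankC; have /row_fullP[D DC] : row_full C by rewrite /row_full rankC.
set u := usubmx C; set C' := dsubmx C; set v := curve_col p.
have CE : C = col_mx u C' by rewrite vsubmxK.
pose cst k l (A : 'M[K]_(k, l)) : 'M[{poly K}]_(k, l) := map_mx polyC A.
have minorE (Q : 'M_(r, p)) :
    cst _ _ (row_mx 0 Q) *m (modif_mx p m *m cst _ _ C) =
    cst _ _ Q *m v *m cst _ _ u + cst _ _ (Q *m C').
  rewrite CE /cst map_row_mx map_col_mx mulmxA /modif_mx mul_row_block.
  by rewrite map_mx0 !mul0mx !add0r mulmx1 mul_row_col map_mxM.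
have [full|/negP not_full] := boolP (row_full C').
  have /row_fullP[Q QC] := full.
  exists (row_mx 0 Q), 0; split=> //; rewrite minorE QC -horner_coef0.
  rewrite -[_.[0]]/(horner_eval 0 _) -det_map_mx map_mxD !map_mxM /=.
  have -> : map_mx (horner_eval 0) v = 0.
    by apply/matrixP => i k; rewrite !mxE /horner_eval hornerXn expr0n.
  by rewrite mulmx0 mul0mx add0r eval_const_mx det1 oner_eq0.
have rC' : (\rank C' < r)%N.
  by rewrite ltn_neqAle rank_leq_col andbT; apply/negP.
have [a0 a0_neq0 Ca0] : exists2 a : 'cV_r, a != 0 & C' *m a = 0.
  have [//|h] := pselect (exists2 a : 'cV_r, a != 0 & C' *m a = 0).
  case: not_full; rewrite /row_full (@full_rank_cV _ _ C') // => a Ca.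
  by apply/eqP/negPn/negP => an; apply: h; exists a.
have ua0 : (u *m a0) 0 0 != 0.
  apply: contra_neq a0_neq0 => ua.
  have ua0 : u *m a0 = 0 by apply/matrixP => i k; rewrite !ord1 ua mxE.
  by rewrite -[a0]mul1mx -DC -mulmxA CE mul_col_mx ua0 Ca0 col_mx0 mulmx0.
pose a := ((u *m a0) 0 0)^-1 *: a0.
have ua : u *m a = 1%:M.
  apply/matrixP => i k.
  by rewrite !ord1 -scalemxAr mxE mulVf // mxE.
have Ca : C' *m a = 0 by rewrite -scalemxAr Ca0 scaler0.
pose G := rsubmx D.
have GC : G *m C' = 1%:M - a *m u.
  have DE : lsubmx D *m u + G *m C' = 1%:M.
    by rewrite -DC -[in RHS](hsubmxK D) CE mul_row_col.
  suff <- : lsubmx D = a by rewrite -DE addrAC subrr add0r.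
  have := congr1 (fun A => A *m a) DE.
  by rewrite mulmxDl -!mulmxA ua Ca mulmx0 addr0 mulmx1 mul1mx.
have [q [j [qC jr qj]]] := kernel_first_coords rp rC'.
(* The projection 1 - a u keeps G C' unchanged and makes u Q depend on q only. *)
pose Q := (1%:M - a *m u) *m G + a *m q.
have u_proj : u *m (1%:M - a *m u) = 0.
  by rewrite mulmxBr mulmx1 mulmxA ua mul1mx subrr.
have proj_a : (1%:M - a *m u) *m a = 0.
  by rewrite mulmxBl mul1mx -mulmxA ua mulmx1 subrr.
have QC : Q *m C' = 1%:M - a *m u.
  rewrite mulmxDl -!mulmxA qC mulmx0 addr0 GC mulmxBr mulmx1 mulmxA proj_a.
  by rewrite mul0mx subr0.
have uQ : u *m Q = q by rewrite mulmxDr !mulmxA u_proj ua mul0mx add0r mul1mx.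
exists (row_mx 0 Q), j.+1; split=> //; rewrite minorE QC.
have -> : cst _ _ Q *m v *m cst _ _ u + cst _ _ (1%:M - a *m u) =
    1%:M - (cst _ _ a - cst _ _ Q *m v) *m cst _ _ u.
  by rewrite /cst map_mxB map_mx1 map_mxM mulmxBl opprB addrCA.
rewrite det_1Bmul mulmxBr mulmxA /cst -!map_mxM ua uQ map_mx1 subKr.
by rewrite coef_row_curve_col.
Qed.

Lemma modif_inverse p (x : K) (v : 'cV[K]_p) : x != 0 ->
  block_mx x%:M 0 v 1%:M *m block_mx (x^-1)%:M 0 (- (x^-1 *: v)) 1%:M = 1%:M
  :> 'M[K]_(1 + p).
Proof.
move=> x0; rewrite mulmx_block !mul0mx !mulmx0 !mul1mx !addr0 !add0r.
by rewrite -scalar_mxM divff // mul_mx_scalar subrr -scalar_mx_block.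
Qed.

End ModificationMatrix.

(** * The modified trivial bundle *)

(** The determinant has no root, so it is a nonzero constant as F is closed. *)
Lemma unitmx_full_rank (F : closedFieldType) n (A : 'M[{poly F}]_n) :
  (forall x, \rank (map_mx (horner_eval x) A) = n) -> A \in unitmx.
Proof.
move=> rA; rewrite unitmxE poly_unitE.
have noroot x : ~~ root (\det A) x.
  have : map_mx (horner_eval x) A \in unitmx.
    by rewrite -row_full_unit /row_full rA.
  by rewrite unitmxE det_map_mx unitfE.
have sz1 : size (\det A) == 1%N.
  apply/negPn/negP => /closed_rootP[x rx].
  by have := noroot x; rewrite rx.
rewrite sz1 unitfE /=; have [c c0 ->] := size_poly1P _ sz1.
by rewrite coefC.
Qed.

Section Modification.
Variable F : closedFieldType.
Local Notation t := (tvar F).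

Lemma subbundle_iso n (E' E : bundle F n) (f : bundle_hom E' E) :
  subbundle f -> bundle_iso f.
Proof.
move=> [/unitmx_full_rank u0 /unitmx_full_rank u1].
have glue := hom_glue f.
have inv_glue : map_mx (@res0 F) (invmx (hom0 f)) *m trans E =
            trans E' *m map_mx (@res1 F) (invmx (hom1 f)).
  have K0 :
      map_mx (@res0 F) (invmx (hom0 f)) *m map_mx (@res0 F) (hom0 f) = 1%:M.
    by rewrite -map_mxM mulVmx // map_mx1.
  have K1 :
      map_mx (@res1 F) (hom1 f) *m map_mx (@res1 F) (invmx (hom1 f)) = 1%:M.
    by rewrite -map_mxM mulmxV // map_mx1.
  by rewrite -[LHS]mulmx1 -K1 mulmxA -[_ *m trans E *m _]mulmxA -glue mulmxA
    K0 mul1mx.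
by exists (BundleHom inv_glue); rewrite /= !mulmxV // !mulVmx.
Qed.

Lemma res_const m n (A : 'M[F]_(m, n)) :
  map_mx (@res0 F) (map_mx polyC A) = map_mx (@res1 F) (map_mx polyC A).
Proof. by apply/matrixP => i j; rewrite !mxE res1C. Qed.

(** Some combination P of the rows of hom0 f is nonsingular.  Multiplied by the
    transition matrix of E', its determinant has exponents of t at least d'; by
    the gluing relation it is also t ^ (N m) times a polynomial in 1/t. *)
Lemma subbundle_degree_le n (E : bundle F n) (N : nat) (T1 : 'M[{poly F}]_n) :
    trans E = t ^+ N *: map_mx (@res1 F) T1 ->
  forall m (E' : bundle F m) (f : bundle_hom E' E) (d' : int),
    has_degree E' d' -> subbundle f -> d' <= (N * m)%:Z.
Proof.
move=> TE m E' f d' [c c0 dE'] [/(_ 0) /left_inverse_at[P dP] _].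
have := hom_glue f; rewrite TE -scalemxAl.
move/(congr1 (fun A => \det (map_mx (@res0 F) (map_mx polyC P) *m A))).
rewrite /= mulmxA -map_mxM det_mulmx det_map_mx dE' res_const.
rewrite -scalemxAr -!map_mxM detZ det_map_mx -exprM exprnP mulrA.
rewrite -res0C -rmorphM => G.
have p0 : \det (map_mx polyC P *m hom0 f) * c%:P != 0.
  by rewrite mulf_neq0 // polyC_eq0.
have q0 : \det (map_mx polyC P *m (T1 *m hom1 f)) != 0.
  apply: contra_neq p0 => q0; move/eqP: G; rewrite q0 rmorph0 mulr0 mulf_eq0.
  by rewrite expfz_eq0 (negPf (tvar_neq0 F)) andbF orbF res0_eq0 => /eqP.
have [_] := size_glue G p0 q0.
by apply: le_trans; rewrite lerDr.
Qed.

Section Construction.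
Variables p m : nat.
Local Notation T := (modif_mx F p m).

Lemma modif_mx_infty : (p < m)%N ->
  map_mx (@res0 F) T = t ^+ m *: map_mx (@res1 F) (modif_mx_at_infty F p m).
Proof.
move=> pm; have t0 k : t ^+ k != 0 by rewrite expf_neq0 // tvar_neq0.
rewrite /modif_mx /modif_mx_at_infty !map_block_mx scale_block_mx.
rewrite !map_scalar_mx /= !map_mx0 !scaler0 !scale_scalar_mx.
rewrite res0X res1X !rmorph1 mulr1 divff //; congr block_mx.
apply/colP => i; rewrite !mxE res0X res1X.
have im : (i.+1 <= m)%N by apply: leq_trans (ltn_ord i) (ltnW pm).
by rewrite -[X in t ^+ X / _](subnK im) exprD mulrAC divff // mul1r.
Qed.

Lemma res0_modif_mx : map_mx (@res0 F) T =
  block_mx (t ^+ m)%:M 0 (map_mx (@res0 F) (curve_col F p)) 1%:M.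
Proof.
rewrite /modif_mx map_block_mx map_mx0 map_mx1.
by rewrite map_scalar_mx /= res0X.
Qed.

Lemma modif_mul_inverse :
  map_mx (@res0 F) T *m
  block_mx (t ^- m)%:M 0 (- (t ^- m *: map_mx (@res0 F) (curve_col F p))) 1%:M
  = 1%:M :> 'M_(1 + p).
Proof.
rewrite res0_modif_mx; apply: modif_inverse.
by rewrite expf_neq0 // tvar_neq0.
Qed.

Lemma modif_unit : map_mx (@res0 F) T \in unitmx.
Proof. exact: proj1 (mulmx1_unit modif_mul_inverse). Qed.

Lemma modif_laurent i j : laurent (map_mx (@res0 F) T i j).
Proof. by rewrite mxE; apply: laurent_res0. Qed.

Lemma laurent_block n1 n2 k1 k2 (A : 'M[funfield F]_(n1, k1))
    (B : 'M[funfield F]_(n1, k2)) (C : 'M[funfield F]_(n2, k1))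
    (D : 'M[funfield F]_(n2, k2)) :
  (forall i j, laurent (A i j)) -> (forall i j, laurent (B i j)) ->
  (forall i j, laurent (C i j)) -> (forall i j, laurent (D i j)) ->
  forall i j, laurent ((block_mx A B C D : 'M_(n1 + n2, k1 + k2)) i j).
Proof.
move=> lA lB lC lD i j; rewrite -(splitK i) -(splitK j).
case: (split i) => i'; case: (split j) => j' /=.
- by rewrite block_mxEul.
- by rewrite block_mxEur.
- by rewrite block_mxEdl.
- by rewrite block_mxEdr.
Qed.

Lemma laurent0 : laurent (0 : funfield F).
Proof. by rewrite -(rmorph0 (@res0 F)); apply: laurent_res0. Qed.

Lemma laurent_scalar k (f : funfield F) : laurent f ->
  forall i j : 'I_k, laurent ((f%:M : 'M_k) i j).
Proof.
by move=> lf i j; rewrite mxE; case: eqP => _; [rewrite mulr1n|exact: laurent0].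
Qed.

Lemma modif_inv_laurent i j : laurent (invmx (map_mx (@res0 F) T) i j).
Proof.
have -> : invmx (map_mx (@res0 F) T) =
  block_mx (t ^- m)%:M 0 (- (t ^- m *: map_mx (@res0 F) (curve_col F p))) 1%:M.
  by rewrite -[LHS]mulmx1 -modif_mul_inverse mulKmx // modif_unit.
apply: laurent_block => {i j} [||i j|].
- by apply: laurent_scalar; apply: laurent_tvarX.
- by move=> i j; rewrite mxE; apply: laurent0.
- rewrite !mxE -mulNr; apply: laurentM; last exact: laurent_res0.
  exists (-1), m; by rewrite rmorphN rmorph1 mulN1r.
- by apply: laurent_scalar; rewrite -(rmorph1 (@res0 F)); apply: laurent_res0.
Qed.

Definition modif_bundle : bundle F (1 + p) :=
  Bundle modif_unit modif_laurent modif_inv_laurent.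

Lemma modif_degree : has_degree modif_bundle m.
Proof.
exists 1; first exact: oner_neq0.
rewrite [trans _]res0_modif_mx det_lblock det1 mulr1 det_scalar1.
by rewrite rmorph1 mul1r.
Qed.

(** The second chart of the modified bundle is framed by the space V itself, so
    that its members are the sections with constant coordinates there. *)
Definition modif_section (c : 'cV[F]_(1 + p)) : local_sections F (1 + p) :=
  (T *m map_mx polyC c, map_mx polyC c).

Definition modif_space : set (local_sections F (1 + p)) := range modif_section.

Lemma modif_space_H0 : modif_space `<=` H0 modif_bundle.
Proof.
by move=> _ [c _ <-]; rewrite /H0 /= map_mxM res_const.
Qed.

Lemma modif_space_dim : subspace_dim modif_space (1 + p).
Proof.
pose b i := modif_section (delta_mx i 0).
have lb c : lincomb b c = modif_section (\col_i c i).
  have F1 : frame1 b = 1%:M.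
    by apply/matrixP => i j; rewrite !mxE andbT; case: eqP.
  have F0 : frame0 b = T.
    apply/matrixP => i j; rewrite mxE /= map_delta_mx -colE mxE //.
  have -> : lincomb b c = lincomb b (fun i => (\col_i c i) i 0).
    by congr lincomb; apply: funext => i; rewrite mxE.
  by rewrite lincomb_frame F0 F1 mul1mx.
exists b; split.
  move=> c; rewrite lb => -[_ /matrixP c0] i.
  by have /eqP := c0 i 0; rewrite !mxE polyC_eq0 => /eqP.
apply/seteqP; split=> [_ [c _ <-]|_ [c _ <-]].
- exists (fun i => c i 0) => //; rewrite lb.
  by congr modif_section; apply/colP => i; rewrite mxE.
- by rewrite lb; eexists.
Qed.

Definition modif_system : coherent_system F (1 + p) m (1 + p) :=
  CoherentSystem modif_degree modif_space_H0 modif_space_dim.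

End Construction.
End Modification.

(** * Stability for large alpha *)

Section SlopeBounds.
Variable R : realType.

(** Missing one section costs alpha / n' in the slope, which for large alpha
    outweighs any bounded gain d' / n' <= N. *)
Lemma slope_lt_few_sections (alpha : R) (n n' k' N : nat) (d' d : int) :
    (0 < n')%N -> (n' <= n)%N -> (k' < n')%N -> d' <= (N * n')%:Z -> 0 <= d ->
    n%:R * N%:R < alpha ->
  slope alpha n' d' k' < slope alpha n d n.
Proof.
move=> n'0 n'n k'n' d'N d0 alphaN.
have n'R : (0 : R) < n'%:R by rewrite ltr0n.
have nR : (0 : R) < n%:R by rewrite ltr0n (leq_trans n'0).
rewrite /slope (divff (lt0r_neq0 nR)) mulr1.
have d'R : d'%:~R / n'%:R <= N%:R :> R.
  by rewrite ler_pdivrMr // -natrM -[_%:R]/((N * n')%:Z%:~R) ler_int.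
have dR : 0 <= d%:~R / n%:R :> R by rewrite divr_ge0 ?ler0z ?ler0n.
have N0 : (0 : R) <= N%:R by rewrite ler0n.
have alpha0 : 0 < alpha by apply: le_lt_trans alphaN; rewrite mulr_ge0 // ltW.
suff : N%:R + alpha * (k'%:R / n'%:R) < alpha by lra.
rewrite -ltrBrDr -[X in X - _]mulr1 -mulrBr.
have -> : 1 - k'%:R / n'%:R = (n'%:R - k'%:R) / n'%:R :> R.
  by field; rewrite lt0r_neq0.
rewrite mulrA ltr_pdivlMr // mulrC.
apply: (@lt_le_trans _ _ alpha).
  by apply: le_lt_trans alphaN; rewrite ler_wpM2r // ler_nat.
have : 1 <= n'%:R - k'%:R :> R by rewrite lerBrDr nat1r ler_nat.
by rewrite -(ler_pM2l alpha0) mulr1.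
Qed.

(** With k' = n' the alpha-terms cancel, and d' / n' <= 1 < d / n decides. *)
Lemma slope_lt_small_degree (alpha : R) (n n' : nat) (d' d : int) :
    (0 < n')%N -> (0 < n)%N -> d' <= n'%:Z -> n%:Z < d ->
  slope alpha n' d' n' < slope alpha n d n.
Proof.
move=> n'0 n0 d'n' nd.
have n'R : (0 : R) < n'%:R by rewrite ltr0n.
have nR : (0 : R) < n%:R by rewrite ltr0n.
rewrite /slope !divff ?lt0r_neq0 // ltrD2r.
apply: (@le_lt_trans _ _ 1).
  by rewrite ler_pdivrMr // mul1r -[_%:R]/(n'%:Z%:~R) ler_int.
by rewrite ltr_pdivlMr // mul1r -[_%:R]/(n%:Z%:~R) ltr_int.
Qed.

End SlopeBounds.

Section Stability.
Variables (F : closedFieldType) (R : realType) (p m : nat).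
Hypothesis pm : (p.+1 < m)%N.
Local Notation t := (tvar F).
Local Notation T := (modif_mx F p m).
Local Notation S := (modif_system F p m).

(** In the second chart the sections of a subsystem become constant vectors, the
    columns of C.  Their independence over F is inherited because the embedding
    is injective on sections. *)
Lemma subsystem_frame n' d' k' (S' : coherent_system F n' d' k')
    (f : bundle_hom S' S) (b : 'I_k' -> local_sections F n') :
    subbundle f ->
    (forall c, lincomb b c = 0 -> forall i, c i = 0) ->
    cs_space S' = [set lincomb b c | c in [set: 'I_k' -> F]] ->
    hom_sections f @` cs_space S' `<=` cs_space S ->
  exists C : 'M[F]_(1 + p, k'),
    [/\ hom0 f *m frame0 b = T *m map_mx polyC C,
        hom1 f *m frame1 b = map_mx polyC C & \rank C = k'].
Proof.
move=> [sub0 sub1] b_free VE fV.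
have b_col i : exists c : 'cV_(1 + p), hom_sections f (b i) = modif_section m c.
  have [|c _ <-] := fV (hom_sections f (b i)); last by exists c.
  by exists (b i) => //; rewrite VE -(lincomb_delta b i); eexists.
have [c cE] := choice b_col.
pose C := \matrix_(i, j) c j i 0 : 'M[F]_(1 + p, k').
have CE j : map_mx polyC (c j) = col j (map_mx polyC C).
  by apply/colP => i; rewrite !mxE.
have col_mul n1 n2 n3 (A : 'M[{poly F}]_(n1, n2)) (B : 'M_(n2, n3)) j :
    col j (A *m B) = A *m col j B by rewrite !colE mulmxA.
have col_eq n1 n2 (A B : 'M[{poly F}]_(n1, n2)) :
    (forall j, col j A = col j B) -> A = B.
  by move=> AB; apply/matrixP => i j; have /colP/(_ i) := AB j; rewrite !mxE.
have E0 : hom0 f *m frame0 b = T *m map_mx polyC C.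
  apply: col_eq => j; rewrite !col_mul -CE.
  have -> : col j (frame0 b) = (b j).1 by apply/colP => i; rewrite !mxE.
  by have [] := cE j.
have E1 : hom1 f *m frame1 b = map_mx polyC C.
  apply: col_eq => j; rewrite col_mul -CE.
  have -> : col j (frame1 b) = (b j).2 by apply/colP => i; rewrite !mxE.
  by have [] := cE j.
exists C; split=> //; apply: full_rank_cV => a Ca.
have Ca' : map_mx polyC C *m map_mx polyC a = 0.
  by rewrite -map_mxM Ca map_mx0.
have inj (M : 'M[{poly F}]_(1 + p, n')) (x : 'cV_n') :
    (forall y, \rank (map_mx (horner_eval y) M) = n') -> M *m x = 0 -> x = 0.
  move=> /(_ 0)/left_inverse_at[P dP] Mx; apply: (det_neq0_inj dP).
  by rewrite -mulmxA Mx mulmx0.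
have b0 : lincomb b (fun i => a i 0) = 0.
  rewrite lincomb_frame; congr (_, _); [apply: inj sub0 _|apply: inj sub1 _].
    by rewrite mulmxA E0 -mulmxA Ca' mulmx0.
  by rewrite mulmxA E1 Ca'.
by apply/colP => i; rewrite (b_free _ b0) mxE.
Qed.

Lemma res0_monomial (h : {poly F}) (a c : F) (e : nat) :
  res0 h = cst_fun c * t ^ e%:Z * cst_fun a -> h = (c * a) *: 'X^e.
Proof.
move=> E; apply: res0_inj; rewrite E -mul_polyC rmorphM /= res0X.
by rewrite [in RHS]res0C rmorphM /= mulrAC.
Qed.

(** A subbundle of rank n' carrying n' independent sections is generated by them
    in the second chart, so its degree is the order at t = 0 of the determinant
    of these sections in the first chart.  That determinant divides every
    maximal minor of T C, one of which has order at most n'. *)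
Lemma generated_degree_le n' d' (S' : coherent_system F n' d' n')
    (f : bundle_hom S' S) (b : 'I_n' -> local_sections F n')
    (C : 'M[F]_(1 + p, n')) :
    (n' <= p)%N -> (forall i, H0 S' (b i)) ->
    hom0 f *m frame0 b = T *m map_mx polyC C ->
    hom1 f *m frame1 b = map_mx polyC C -> \rank C = n' ->
  d' <= n'%:Z.
Proof.
move=> n'p bH E0 E1 rC; rewrite leNgt; apply/negP => d'n'.
have [e d'e] : exists e : nat, d' = e%:Z by exists (absz d'); lia.
have /row_fullP[D DC] : row_full C by rewrite /row_full rC.
(* D (hom1 f) inverts frame1 b, which makes its determinant a constant. *)
have [a a0 aE] : exists2 a, a != 0 & \det (frame1 b) = a%:P.
  have : frame1 b \in unitmx.
    suff /mulmx1_unit[] : map_mx polyC D *m hom1 f *m frame1 b = 1%:M by [].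
    by rewrite -mulmxA E1 -map_mxM DC map_mx1.
  by rewrite unitmxE poly_unitE => /andP[/size_poly1P[a a0 ->] _]; exists a.
have [c c0 dE] := cs_degree S'.
have D0E : \det (frame0 b) = (c * a) *: 'X^e.
  apply: res0_monomial; rewrite -d'e -dE -res1C -aE.
  have := congr1 (fun A => \det A) (frame_glue bH).
  by rewrite /= det_mulmx !det_map_mx.
have [P [j [jn' /eqP[]]]] := low_order_minor m n'p rC.
rewrite -E0 mulmxA det_mulmx D0E -scalerAr coefZ coefMXn.
have -> : (j < e)%N by rewrite d'e in d'n'; lia.
by rewrite mulr0.
Qed.

Lemma full_subsystem_iso d' (S' : coherent_system F (1 + p) d' (1 + p))
    (f : bundle_hom S' S) (b : 'I_(1 + p) -> local_sections F (1 + p))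
    (C : 'M[F]_(1 + p)) :
    subbundle f -> hom_sections f @` cs_space S' `<=` cs_space S ->
    cs_space S' = [set lincomb b c | c in [set: 'I_(1 + p) -> F]] ->
    hom0 f *m frame0 b = T *m map_mx polyC C ->
    hom1 f *m frame1 b = map_mx polyC C -> \rank C = (1 + p)%N ->
  cs_iso f.
Proof.
move=> subf fV VE E0 E1 rC; split; first exact: subbundle_iso.
apply/seteqP; split=> // _ [x _ <-].
have Cu : C \in unitmx by rewrite -row_full_unit /row_full rC.
exists (lincomb b (fun i => (invmx C *m x) i 0)); first by rewrite VE; eexists.
rewrite lincomb_frame /hom_sections /= !mulmxA E0 E1 -[T *m _ *m _]mulmxA.
by rewrite -map_mxM mulKVmx.
Qed.

(** Constancy of the sections gives k' <= n' by evaluation at one point.  If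
    k' < n', large alpha wins; if k' = n' <= p, the degree is at most n'; and if
    k' = n' = 1 + p, the subsystem is everything. *)
Lemma modif_stable (alpha : R) :
  (1 + p)%:R * m%:R < alpha -> stable alpha S.
Proof.
move=> alpha_big n' d' k' S' f [[n'0 subf fV] not_iso].
have [b [b_free VE]] := cs_space_dim S'.
have [C [E0 E1 rC]] := subsystem_frame subf b_free VE fV.
have bH i : H0 S' (b i).
  by apply: cs_space_H0; rewrite VE -(lincomb_delta b i); eexists.
have k'n' : (k' <= n')%N.
  rewrite -[k']rC -(eval_const_mx C 0) -E1 map_mxM.
  by apply: leq_trans (mxrankM_maxl _ _) (rank_leq_col _).
have n'p : (n' <= 1 + p)%N.
  by have [_ /(_ 0) <-] := subf; apply: rank_leq_row.
have [k'_lt|k'_ge] := ltnP k' n'.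
  apply: (@slope_lt_few_sections _ _ _ _ _ m) => //.
  have TE : trans S = _ := modif_mx_infty F (ltnW pm).
  by apply: (subbundle_degree_le TE) (cs_degree S') subf.
have kn : k' = n' by apply/eqP; rewrite eqn_leq k'n'.
subst k'.
have [n'_lt|n'_ge] := leqP n' p.
  apply: slope_lt_small_degree => //.
  exact: generated_degree_le bH E0 E1 rC.
have nn : n' = (1 + p)%N by apply/eqP; rewrite eqn_leq n'p.
subst n'.
by case: not_iso; apply: full_subsystem_iso subf fV VE E0 E1 rC.
Qed.

End Stability.

Theorem proposition6p3 (F : closedFieldType) (R : realType) (n : nat) (d : int)
    (hn : (2 <= n)%N) :
  ((exists alpha : R, moduli F alpha n d n !=set0) <-> n%:Z < d) /\
  (n%:Z < d -> ~ has_ubound [set alpha : R | moduli F alpha n d n !=set0]).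
Proof.
have large_alpha : n%:Z < d -> forall alpha : R, n%:R * d%:~R < alpha ->
    moduli F alpha n d n !=set0.
  case: n hn => // p _; case: d => [m|//]; rewrite ltz_nat => pm alpha big.
  eexists; exists (modif_system F p m); last by [].
  exact: modif_stable big.
split; first split.
- by move=> [alpha [_ [S stS _]]]; apply: stable_degree_gt hn stS.
- move=> nd; exists (n%:R * d%:~R + 1); apply: large_alpha => //.
  by rewrite ltrDl.
- move=> nd [B ubB].
  pose M := Num.max B (n%:R * d%:~R).
  have lt_M x : x <= M -> x < M + 1 by move/le_lt_trans; apply; rewrite ltrDl.
  have : M + 1 <= B.
    apply: ubB; apply: large_alpha => //; apply: lt_M.
    by rewrite le_max lexx orbT.
  by rewrite leNgt lt_M // le_max lexx.
Qed.
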